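(* Let $(X,d)$ be a geodesic metric space. Then $X$ is hyperbolic if and only if there is a constant $C\ge 0$ such that for all $x,y\in X$ and all $s,t\ge 0$ with $B(x,s)\cap B(y,t)\neq\emptyset$ there exist $\xi\in X$ and $R\ge 0$ with $d_H\big(B(x,s)\cap B(y,t),\,B(\xi,R)\big)\le C$.
   Context: $B(x,r)=\{z\in X: d(x,z)\le r\}$ denotes the closed ball. For $A,B\subseteq X$, the Hausdorff distance is $d_H(A,B)=\inf\{r\ge 0: A\subseteq N_r(B),\ B\subseteq N_r(A)\}$, where $N_r(A)$ is the $r$-neighbourhood of $A$. A geodesic metric space is $\delta$-hyperbolic ($\delta\ge0$) if for every geodesic triangle each side is contained in the $\delta$-neighbourhood of the union of the other two sides; it is hyperbolic if it is $\delta$-hyperbolic for some $\delta\ge0$. *)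

(* Defs.v *)
From Stdlib Require Import Reals.
From Coquelicot Require Import Coquelicot.
Open Scope R_scope.

Section Metric.
Context {X : Type} (d : X -> X -> R).

Definition is_metric : Prop :=
  (forall x y, 0 <= d x y) /\
  (forall x y, d x y = 0 <-> x = y) /\
  (forall x y, d x y = d y x) /\
  (forall x y z, d x z <= d x y + d y z).

Definition geodesic_segment (x y : X) (S : X -> Prop) : Prop :=
  exists g : R -> X,
    g 0 = x /\ g (d x y) = y /\
    (forall s t, 0 <= s <= d x y -> 0 <= t <= d x y ->
       d (g s) (g t) = Rabs (s - t)) /\
    (forall p, S p <-> exists t, 0 <= t <= d x y /\ g t = p).

Definition geodesic_space : Prop :=
  forall x y : X, exists S, geodesic_segment x y S.

Definition in_closed_nbhd (A B : X -> Prop) (delta : R) : Prop :=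
  forall p, A p -> exists q, B q /\ d p q <= delta.

Definition set_union (A B : X -> Prop) : X -> Prop := fun p => A p \/ B p.
Definition set_inter (A B : X -> Prop) : X -> Prop := fun p => A p /\ B p.

Definition delta_hyperbolic (delta : R) : Prop :=
  0 <= delta /\
  forall (x y z : X) (Sxy Syz Szx : X -> Prop),
    geodesic_segment x y Sxy -> geodesic_segment y z Syz ->
    geodesic_segment z x Szx ->
    in_closed_nbhd Sxy (set_union Syz Szx) delta /\
    in_closed_nbhd Syz (set_union Szx Sxy) delta /\
    in_closed_nbhd Szx (set_union Sxy Syz) delta.

Definition hyperbolic : Prop := exists delta, delta_hyperbolic delta.

Definition cball (x : X) (r : R) : X -> Prop := fun z => d x z <= r.

Definition nbhd (r : R) (A : X -> Prop) : X -> Prop :=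
  fun p => exists a, A a /\ d p a < r.

Definition subset (A B : X -> Prop) : Prop := forall p, A p -> B p.

(* Hausdorff distance, valued in extended reals (inf of empty set = +oo) *)
Definition hausdorff (A B : X -> Prop) : Rbar :=
  Glb_Rbar (fun r => 0 <= r /\ subset A (nbhd r B) /\ subset B (nbhd r A)).

End Metric.

(* Main.v *)
(** If X is delta-hyperbolic and D = d(x,y), the nondegenerate lenses B(x,s) ∩ B(y,t) are 2 delta-close to the ball of radius (s+t-D)/2 about the corresponding point of [x,y].

Conversely, a ball close to a lens has radius at most s+t-D up to a constant, so the diameter of the lens is bounded linearly in s+t-D ([lens_bound]). Hence two geodesics g, h from x at bounded distance contract on the way to x: otherwise the length excess of crossing from g to h would be almost constant over three nested windows of heights, and crossing early or late would give almost geodesic bigons whose sides are far apart. By bisection, geodesics from x to the ends of a path of length l outside B(x,H) are close at height H - O(log l). Along [y,z], the distance to x therefore grows linearly away from a point p almost nearest to x, and a dyadic decomposition improves the logarithm to a constant: p is near both [x,y] and [x,z]. A point near all three sides makes the triangle thin, since geodesics with close ends fellow-travel. *)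
Require Import Defs.
From Stdlib Require Import Reals.
From Coquelicot Require Import Coquelicot.
From Stdlib Require Import Lra Lia.
Open Scope R_scope.

Section Geodesics.
Context {X : Type} (d : X -> X -> R).
Hypothesis Hmetric : is_metric d.
Hypothesis Hgeod : geodesic_space d.

(** * Metric axioms and geodesic paths *)

Lemma dist_ge0 x y : 0 <= d x y.
Proof. apply Hmetric. Qed.

Lemma dist_refl x : d x x = 0.
Proof. destruct Hmetric as (_ & H & _). now apply H. Qed.

Lemma dist_sym x y : d x y = d y x.
Proof. apply Hmetric. Qed.

Lemma dist_tri x y z : d x z <= d x y + d y z.
Proof. apply Hmetric. Qed.

Definition geodesic_path (g : R -> X) (T : R) : Prop :=
  0 <= T /\
  forall s t, 0 <= s <= T -> 0 <= t <= T -> d (g s) (g t) = Rabs (s - t).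

Lemma path_dist g T s t :
  geodesic_path g T -> 0 <= s -> s <= t -> t <= T -> d (g s) (g t) = t - s.
Proof.
  intros [_ Hg] Hs Hst Ht. rewrite Hg by lra.
  rewrite Rabs_minus_sym. apply Rabs_pos_eq. lra.
Qed.

Lemma path_dist0 g T s :
  geodesic_path g T -> 0 <= s -> s <= T -> d (g 0) (g s) = s.
Proof. intros Hg Hs Ht. rewrite (path_dist g T) by (trivial; lra). lra. Qed.

Lemma path_restrict g T T' :
  geodesic_path g T -> 0 <= T' -> T' <= T -> geodesic_path g T'.
Proof. intros [H0 Hg] H1 H2. split; [lra|]. intros; apply Hg; lra. Qed.

Lemma path_shift g T a :
  geodesic_path g T -> 0 <= a -> a <= T ->
  geodesic_path (fun t => g (a + t)) (T - a).
Proof.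
  intros [H0 Hg] H1 H2. split; [lra|]. intros; rewrite Hg by lra.
  f_equal; lra.
Qed.

Lemma path_reverse g T a :
  geodesic_path g T -> 0 <= a -> a <= T ->
  geodesic_path (fun t => g (a - t)) a.
Proof.
  intros [H0 Hg] H1 H2. split; [lra|]. intros; rewrite Hg by lra.
  rewrite Rabs_minus_sym. f_equal; lra.
Qed.

Lemma segment_path x y S :
  geodesic_segment d x y S ->
  exists g, geodesic_path g (d x y) /\ g 0 = x /\ g (d x y) = y /\
    (forall p, S p <-> exists t, 0 <= t <= d x y /\ g t = p).
Proof.
  intros (g & H0 & H1 & H2 & H3). exists g. repeat split; try easy.
  - apply dist_ge0.
  - apply H3.
  - apply H3.
Qed.

Lemma path_exists x y :
  exists g, geodesic_path g (d x y) /\ g 0 = x /\ g (d x y) = y.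
Proof.
  destruct (Hgeod x y) as [S HS].
  destruct (segment_path x y S HS) as (g & H0 & H1 & H2 & _). eauto.
Qed.

Lemma segment_dist x y S p :
  geodesic_segment d x y S -> S p -> d x p + d p y = d x y.
Proof.
  intros HS Hp. destruct (segment_path x y S HS) as (g & Hg & Hx & Hy & Hin).
  apply Hin in Hp. destruct Hp as (t & Ht & <-).
  rewrite <- Hx at 1. rewrite <- Hy at 1.
  rewrite (path_dist g (d x y)), (path_dist g (d x y)) by (trivial; lra). lra.
Qed.

Lemma segment_sym x y S :
  geodesic_segment d x y S -> geodesic_segment d y x S.
Proof.
  intros HS. destruct (segment_path x y S HS) as (g & Hg & Hx & Hy & Hin).
  pose proof (dist_ge0 x y).
  destruct (path_reverse g _ (d x y) Hg) as [_ Hr]; try lra.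
  exists (fun t => g (d x y - t)). rewrite (dist_sym y x).
  split; [now rewrite Rminus_0_r|].
  split; [now rewrite Rminus_diag|].
  split; [exact Hr|].
  intros p. rewrite Hin. split; intros (t & Ht & <-); exists (d x y - t);
    (split; [lra|f_equal; lra]).
Qed.

(** * The Hausdorff distance as an infimum *)

Lemma hausdorff_le (A B : X -> Prop) C :
  0 <= C ->
  (forall r, C < r -> subset A (nbhd d r B) /\ subset B (nbhd d r A)) ->
  Rbar_le (hausdorff d A B) (Finite C).
Proof.
  intros HC H. unfold hausdorff.
  set (E := fun r => _). destruct (Glb_Rbar_correct E) as [Hlb _].
  assert (HE : forall r, C < r -> Rbar_le (Glb_Rbar E) (Finite r)).
  { intros r Hr. apply Hlb. split; [lra|auto]. }
  destruct (Glb_Rbar E) as [l| |]; simpl in *.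
  - apply Rnot_lt_le. intros Hl. specialize (HE ((C + l) / 2)). lra.
  - apply (HE (C + 1)). lra.
  - exact I.
Qed.

(** The infimum need not be attained; the slack 1 provides an admissible radius. *)
Lemma hausdorff_le_elim (A B : X -> Prop) C :
  Rbar_le (hausdorff d A B) (Finite C) ->
  (forall p, A p -> exists q, B q /\ d p q <= C + 1) /\
  (forall p, B p -> exists q, A q /\ d p q <= C + 1).
Proof.
  intros H. unfold hausdorff in H.
  set (E := fun r => _) in H. destruct (Glb_Rbar_correct E) as [_ Hglb].
  assert (HE : exists r, E r /\ r < C + 1).
  { apply Classical_Prop.NNPP. intros HN.
    assert (Rbar_le (Finite (C + 1)) (Glb_Rbar E)) as H1.
    { apply Hglb. intros r Hr. simpl. apply Rnot_lt_le. intros Hl. eauto. }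
    pose proof (Rbar_le_trans _ _ _ H1 H) as H2. simpl in H2. lra. }
  destruct HE as (r & (_ & H1 & H2) & Hr).
  split; intros p Hp; [destruct (H1 p Hp) as (q & Hq & Hd)|destruct (H2 p Hp) as (q & Hq & Hd)];
    exists q; split; trivial; lra.
Qed.

Lemma hausdorff_equiv (A B : X -> Prop) C :
  0 <= C -> (forall p, A p <-> B p) ->
  Rbar_le (hausdorff d A B) (Finite C).
Proof.
  intros HC H. apply hausdorff_le; trivial.
  intros r Hr; split; intros p Hp; exists p; rewrite dist_refl;
    (split; [now apply H|lra]).
Qed.

(** * Hyperbolicity makes lenses close to balls *)

Lemma hyperbolic_ball_inter delta x y s t :
  delta_hyperbolic d delta -> 0 <= s -> 0 <= t ->
  (exists z, set_inter (cball d x s) (cball d y t) z) ->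
  exists (xi : X) (R0 : R), 0 <= R0 /\
    Rbar_le (hausdorff d (set_inter (cball d x s) (cball d y t)) (cball d xi R0))
            (Finite (2 * delta)).
Proof.
  intros [Hd Hthin] Hs Ht [z0 [Hz1 Hz2]]. unfold cball in Hz1, Hz2.
  assert (HD : d x y <= s + t).
  { pose proof (dist_tri x z0 y). rewrite (dist_sym z0 y) in H. lra. }
  (* In the first two cases one ball contains the other, and the lens is a ball. *)
  destruct (Rle_lt_dec (s + d x y) t) as [H1|H1].
  { exists x, s. split; trivial. apply hausdorff_equiv; [lra|].
    unfold set_inter, cball. intros p. split; [tauto|]. intros Hp.
    split; trivial. pose proof (dist_tri y x p). rewrite (dist_sym y x) in H. lra. }
  destruct (Rle_lt_dec (t + d x y) s) as [H2|H2].
  { exists y, t. split; trivial. apply hausdorff_equiv; [lra|].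
    unfold set_inter, cball. intros p. split; [tauto|]. intros Hp.
    split; trivial. pose proof (dist_tri x y p). lra. }
  destruct (Hgeod x y) as [Sxy HSxy].
  destruct (segment_path x y Sxy HSxy) as (g & Hg & Hx & Hy & Hin).
  (* Chosen so that both balls reach equally far beyond [w]: [s - a = t - (d x y - a) = r]. The
     excluded cases give [0 < a < d x y]. *)
  set (a := (s - t + d x y) / 2). set (w := g a).
  assert (Hxw : d x w = a).
  { rewrite <- Hx at 1. apply (path_dist0 g (d x y)); unfold a; trivial; lra. }
  assert (Hyw : d y w = d x y - a).
  { rewrite <- Hy at 1. rewrite dist_sym.
    apply (path_dist g (d x y)); unfold a; trivial; lra. }
  assert (Hw : Sxy w) by (apply Hin; exists a; unfold a; split; [lra|reflexivity]).
  set (r := (s + t - d x y) / 2).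
  assert (Ha : a + r = s) by (unfold a, r; lra).
  assert (Hb : d x y - a + r = t) by (unfold a, r; lra).
  assert (Hr : 0 <= r) by (unfold r; lra).
  clearbody r w a.
  exists w, r. split; trivial. apply hausdorff_le; [lra|].
  intros r' Hr'. split; intros z Hz.
  - destruct Hz as [Hzx Hzy]. unfold cball in Hzx, Hzy.
    (* A point [q] of another side is within [delta] of [w]. If [q] is on [y,z], then
       [d y q >= d x y - a - delta] leaves at most [r + delta] for [d q z]; [z,x] is symmetric. *)
    assert (Hzw : d w z <= r + 2 * delta).
    { destruct (Hgeod y z) as [Syz HSyz]. destruct (Hgeod z x) as [Szx HSzx].
      destruct (Hthin x y z _ _ _ HSxy HSyz HSzx) as [Hthin' _].
      destruct (Hthin' w Hw) as (q & [Hq|Hq] & Hwq).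
      - pose proof (segment_dist _ _ _ q HSyz Hq).
        pose proof (dist_tri w q z). pose proof (dist_tri y q w).
        rewrite (dist_sym q w) in *. lra.
      - pose proof (segment_dist _ _ _ q HSzx Hq).
        pose proof (dist_tri w q z). pose proof (dist_tri x q w).
        rewrite (dist_sym q w), (dist_sym q z), (dist_sym q x), (dist_sym z x) in *. lra. }
    destruct (Rle_lt_dec (d w z) r) as [H3|H3].
    { exists z. rewrite dist_refl. split; [exact H3|lra]. }
    destruct (path_exists w z) as (h & Hh & Hh0 & Hh1).
    exists (h r). unfold cball. split.
    + rewrite <- Hh0 at 1. rewrite (path_dist0 h (d w z)); trivial; lra.
    + rewrite <- Hh1 at 1. rewrite dist_sym, (path_dist h (d w z)); trivial; lra.
  - exists z. rewrite dist_refl. split; [|lra]. unfold cball in Hz.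
    pose proof (dist_tri x w z). pose proof (dist_tri y w z).
    split; unfold cball; lra.
Qed.

(** * The diameter of lenses *)

Definition lens_bound (K : R) : Prop :=
  forall x y s t z z', d x z <= s -> d x z' <= s -> d y z <= t -> d y z' <= t ->
    d z z' <= 2 * (s + t - d x y) + K.

(** All distances from [x] to the lens lie in an interval of length [s + t - d x y]. The ball
    contains [xi] and, if [r <= d xi x], a point nearer to [x] by [r]; both are near the lens, so
    [r <= s + t - d x y + 2 * (C + 1)]. Passing from radius to diameter gives the factor 2. *)
Lemma ball_inter_lens_bound C :
  0 <= C ->
  (forall (x y : X) (s t : R), 0 <= s -> 0 <= t ->
      (exists z, set_inter (cball d x s) (cball d y t) z) ->
      exists (xi : X) (R0 : R), 0 <= R0 /\
        Rbar_le (hausdorff d (set_inter (cball d x s) (cball d y t))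
                             (cball d xi R0))
                (Finite C)) ->
  lens_bound (6 * (C + 1)).
Proof.
  intros HC Hball x y s t z z' Hxz Hxz' Hyz Hyz'.
  pose proof (dist_ge0 x z). pose proof (dist_ge0 y z).
  destruct (Hball x y s t) as (xi & r & Hr & Hh); try lra.
  { exists z. now split. }
  apply hausdorff_le_elim in Hh. destruct Hh as [HA HB].
  destruct (HA z) as (q & Hq & Hzq); [now split|].
  destruct (HA z') as (q' & Hq' & Hzq'); [now split|].
  unfold cball in Hq, Hq'.
  assert (Hzz : d z z' <= 2 * r + 2 * (C + 1)).
  { pose proof (dist_tri z q z'). pose proof (dist_tri q xi z').
    pose proof (dist_tri xi q' z').
    rewrite (dist_sym q xi), (dist_sym q' z') in *. lra. }
  assert (Hxy : forall i, set_inter (cball d x s) (cball d y t) i -> d x y - t <= d x i <= s).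
  { intros i [Hi1 Hi2]. unfold cball in *.
    pose proof (dist_tri x i y). rewrite (dist_sym i y) in *. lra. }
  destruct (Rle_lt_dec r (d xi x)) as [Hrx|Hrx].
  - destruct (HB xi) as (i & Hi & Hxi).
    { unfold cball. now rewrite dist_refl. }
    destruct (path_exists xi x) as (g & Hg & Hg0 & Hg1).
    assert (H1 : d xi (g r) = r).
    { rewrite <- Hg0 at 1. apply (path_dist0 g (d xi x)); trivial; lra. }
    assert (H2 : d (g r) x = d xi x - r).
    { rewrite <- Hg1 at 1. apply (path_dist g (d xi x)); trivial; lra. }
    destruct (HB (g r)) as (j & Hj & Hgj).
    { unfold cball. lra. }
    apply Hxy in Hi. apply Hxy in Hj.
    pose proof (dist_tri x i xi). pose proof (dist_tri x (g r) j).
    rewrite (dist_sym i xi), (dist_sym x xi), (dist_sym x (g r)) in *. lra.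
  (* Here [x] is in the ball, hence near the lens: [d x y - t <= C + 1], and the diameter bound
     [2 * s] suffices. *)
  - destruct (HB x) as (i & Hi & Hxi).
    { unfold cball. lra. }
    apply Hxy in Hi. pose proof (dist_tri z x z'). rewrite (dist_sym z x) in *. lra.
Qed.

Section Lens.
Variable K : R.
Hypothesis HK : 1 <= K.
Hypothesis Hlens : lens_bound K.

(** * Contraction of geodesics with a common start *)

Section TwoPaths.
Variables (g h : R -> X) (T : R).
Hypothesis Hg : geodesic_path g T.
Hypothesis Hh : geodesic_path h T.
Hypothesis Hgh : g 0 = h 0.

(* The length excess, over the height difference, of a crossing from [g] at height [a] up to [h] at height [b]; it can only decrease when the window [a, b] is enlarged. *)
Definition excess (a b : R) : R := d (g a) (h b) - (b - a).

Lemma excess_ge0 a b : 0 <= a <= T -> 0 <= b <= T -> 0 <= excess a b.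
Proof.
  intros Ha Hb. unfold excess.
  pose proof (path_dist0 g T a Hg) as H1. pose proof (path_dist0 h T b Hh) as H2.
  pose proof (dist_tri (g 0) (g a) (h b)). rewrite Hgh in *.
  rewrite H1, H2 in * by lra. lra.
Qed.

Lemma excess_mono a a' b b' :
  0 <= a <= a' -> a' <= T -> 0 <= b' <= b -> b <= T ->
  excess a b <= excess a' b'.
Proof.
  intros. unfold excess.
  pose proof (path_dist g T a a' Hg). pose proof (path_dist h T b' b Hh).
  pose proof (dist_tri (g a) (g a') (h b)). pose proof (dist_tri (g a') (h b') (h b)).
  lra.
Qed.

(** Both points lie in the lens of radii [a] about [g 0] and [d (g a) (h b)] about [h b], whose
    [s + t - D] is exactly the excess. *)
Lemma excess_fellow a b :
  0 <= a <= b -> b <= T -> d (g a) (h a) <= 2 * excess a b + K.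
Proof.
  intros Ha Hb. unfold excess.
  pose proof (path_dist0 g T a Hg) as H1. pose proof (path_dist0 h T a Hh) as H2.
  pose proof (path_dist0 h T b Hh) as H3. pose proof (path_dist h T a b Hh) as H4.
  pose proof (excess_ge0 a b) as H5. unfold excess in H5.
  pose proof (Hlens (g 0) (h b) a (d (g a) (h b)) (g a) (h a)) as H6.
  rewrite (dist_sym (h b) (g a)), (dist_sym (h b) (h a)) in H6.
  rewrite Hgh in *. lra.
Qed.

(* If the excess is almost the same over [a1, a2], [a2 + c, a3] and [a1, a3], then from [g a1] to [h a3] one may go through [h a2] or through [g (a2 + c)] almost geodesically; these are at the same distance from [g a1], hence close to each other, although their heights differ by [c]. *)
Lemma excess_bigon sg a1 a2 a3 :
  0 <= a1 <= a2 -> a2 <= T -> a2 + excess a1 a2 <= a3 -> a3 <= T ->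
  excess a1 a2 <= excess a1 a3 + sg ->
  excess (a2 + excess a1 a2) a3 <= excess a1 a3 + sg ->
  excess a1 a2 <= 2 * sg + K.
Proof.
  intros H1 H1' H2 H3 H4 H5.
  assert (Hc : 0 <= excess a1 a2) by (apply excess_ge0; lra).
  remember (excess a1 a2) as c eqn:Ec.
  unfold excess in *.
  pose proof (path_dist g T a1 (a2 + c) Hg) as D1.
  pose proof (path_dist h T a2 a3 Hh) as D2.
  pose proof (Hlens (g a1) (h a3) (a2 + c - a1) (d (g a1) (h a3) - (a2 + c - a1) + sg)
     (h a2) (g (a2 + c))) as D3.
  rewrite (dist_sym (h a3) (h a2)), (dist_sym (h a3) (g (a2 + c))) in D3.
  pose proof (path_dist0 g T (a2 + c) Hg) as D4.
  pose proof (path_dist0 h T a2 Hh) as D5.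
  pose proof (dist_tri (g 0) (h a2) (g (a2 + c))) as D6.
  rewrite Hgh in *. lra.
Qed.

(** Room for two windows of the previous length and, between them, the gap of [excess_bigon], which
    is an excess and at most [M]. *)
Fixpoint window_length (M : R) (n : nat) : R :=
  match n with O => 0 | S n => 2 * window_length M n + M end.

Lemma window_length_ge0 M n : 0 <= M -> 0 <= window_length M n.
Proof. intros HM. induction n; simpl; lra. Qed.

(* By [excess_bigon], unless the excess is small, one half of a window has an excess larger by [sg] than the whole: iterate. *)
Lemma excess_window M sg n a b :
  0 <= sg -> (forall l, 0 <= l <= T -> d (g l) (h l) <= M) ->
  0 <= a -> a + window_length M n <= b -> b <= T ->
  (exists a' b', a <= a' <= b' /\ b' <= b /\ excess a' b' <= 2 * sg + K) \/
  (exists a' b', a <= a' <= b' /\ b' <= b /\ excess a b + INR n * sg <= excess a' b').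
Proof.
  intros Hsg HM.
  assert (HM0 : 0 <= M).
  { pose proof (proj1 Hg). pose proof (HM 0). pose proof (dist_ge0 (g 0) (h 0)). lra. }
  revert a b. induction n as [|n IH]; intros a b Ha Hab Hb.
  { simpl in *. right. exists a, b. lra. }
  rewrite S_INR. simpl window_length in Hab.
  pose proof (window_length_ge0 M n HM0) as HL.
  set (a2 := a + window_length M n).
  assert (Hc : 0 <= excess a a2) by (apply excess_ge0; unfold a2; lra).
  assert (HcM : excess a a2 <= M).
  { apply Rle_trans with (excess a a).
    - apply excess_mono; unfold a2; lra.
    - unfold excess. specialize (HM a). lra. }
  destruct (Rle_lt_dec (excess a a2) (excess a b + sg)) as [H1|H1].
  - destruct (Rle_lt_dec (excess (a2 + excess a a2) b) (excess a b + sg)) as [H2|H2].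
    + left. exists a, a2. split; [unfold a2; lra|]. split; [unfold a2; lra|].
      apply (excess_bigon sg a a2 b); trivial; unfold a2 in *; lra.
    + destruct (IH (a2 + excess a a2) b) as [(a' & b' & I)|(a' & b' & I)];
        try (unfold a2 in *; lra); [left|right]; exists a', b'; unfold a2 in *; lra.
  - destruct (IH a a2) as [(a' & b' & I)|(a' & b' & I)];
      try (unfold a2 in *; lra); [left|right]; exists a', b'; unfold a2 in *; lra.
Qed.

End TwoPaths.

(** Use the lens of radii [l] about the start and [d (g l) (h Th)] about [h Th]: its [s + t - D] is
    at most twice the distance of the ends. *)
Lemma path_fellow g h Tg Th l :
  geodesic_path g Tg -> geodesic_path h Th -> g 0 = h 0 ->
  0 <= l -> l <= Tg -> l <= Th ->
  d (g l) (h l) <= 4 * d (g Tg) (h Th) + K.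
Proof.
  intros Hg Hh Hgh H0 H1 H2.
  pose proof (path_dist g Tg l Tg Hg) as D1. pose proof (path_dist h Th l Th Hh) as D2.
  pose proof (path_dist0 g Tg l Hg) as D3. pose proof (path_dist0 h Th l Hh) as D4.
  pose proof (path_dist0 h Th Th Hh) as D5. pose proof (path_dist0 g Tg Tg Hg) as D6.
  pose proof (dist_tri (g l) (g Tg) (h Th)) as E1.
  pose proof (dist_tri (g 0) (g l) (h Th)) as E2.
  pose proof (dist_tri (g 0) (h Th) (g Tg)) as E3.
  rewrite (dist_sym (h Th) (g Tg)) in E3.
  pose proof (Hlens (g 0) (h Th) l (d (g l) (h Th)) (g l) (h l)) as E4.
  rewrite (dist_sym (h Th) (g l)), (dist_sym (h Th) (h l)) in E4.
  rewrite Hgh in *. lra.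
Qed.

(** Only [N] depends on [r0]. With [sg = K], a window of excess at most [3 * K] yields [7 * K] by
    [excess_fellow]; otherwise [n] gains of [K] would exceed the upper bound [M] on every excess. *)
Lemma path_contraction r0 :
  0 <= r0 ->
  exists N, 0 <= N /\ forall g h T l,
    geodesic_path g T -> geodesic_path h T -> g 0 = h 0 ->
    d (g T) (h T) <= r0 -> 0 <= l -> l + N <= T -> d (g l) (h l) <= 7 * K.
Proof.
  intros Hr0. set (M := 4 * r0 + K).
  destruct (INR_archimed 1 M) as [n Hn]; [lra|].
  assert (HM : 0 <= M) by (unfold M; lra).
  pose proof (window_length_ge0 M n HM) as HL.
  exists (window_length M n). split; trivial.
  intros g h T l Hg Hh Hgh HT Hl HlT.
  assert (HM' : forall l, 0 <= l <= T -> d (g l) (h l) <= M).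
  { intros l' Hl'. pose proof (path_fellow g h T T l' Hg Hh Hgh). unfold M. lra. }
  destruct (excess_window g h T Hg Hh Hgh M K n l T) as [(a' & b' & I)|(a' & b' & I)]; try lra; trivial.
  - pose proof (excess_mono g h T Hg Hh l a' b' b').
    pose proof (excess_fellow g h T Hg Hh Hgh l b'). lra.
  - exfalso.
    pose proof (excess_mono g h T Hg Hh a' a' b' a').
    pose proof (excess_ge0 g h T Hg Hh Hgh l T).
    assert (excess g h a' a' <= M).
    { unfold excess. specialize (HM' a'). lra. }
    pose proof (Rmult_le_compat_l (INR n) 1 K (pos_INR n) HK). lra.
Qed.

(** * Geodesics to the ends of a path outside a ball *)

Section Divergence.
Variable L : R.
Hypothesis HL : 0 <= L.
Hypothesis Hcontr : forall g h T l,
  geodesic_path g T -> geodesic_path h T -> g 0 = h 0 ->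
  d (g T) (h T) <= 14 * K -> 0 <= l -> l + L <= T -> d (g l) (h l) <= 7 * K.

(** Bisect the path: the two halves give [7 * K] each, and descending by [L] contracts their sum
    [14 * K] to [7 * K] again. At length [K], [path_fellow] gives [5 * K]. *)
Lemma outer_path_close n c H u v g h Tg Th l :
  u <= v -> v - u <= 2 ^ n * K ->
  (forall s t, u <= s -> s <= t -> t <= v -> d (c s) (c t) <= t - s) ->
  geodesic_path g Tg -> geodesic_path h Th -> g 0 = h 0 ->
  g Tg = c u -> h Th = c v ->
  (forall t, u <= t <= v -> H <= d (g 0) (c t)) ->
  0 <= l -> l + INR n * L <= H ->
  d (g l) (h l) <= 7 * K.
Proof.
  revert u v g h Tg Th l.
  induction n as [|n IH]; intros u v g h Tg Th l Huv Hlen Hc Hg Hh Hgh Hgu Hhv HH Hl HlH;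
    pose proof (path_dist0 g Tg Tg Hg (proj1 Hg) (Rle_refl _)) as DTg;
    pose proof (path_dist0 h Th Th Hh (proj1 Hh) (Rle_refl _)) as DTh;
    rewrite Hgu in DTg; rewrite Hhv, <- Hgh in DTh;
    pose proof (HH u ltac:(lra)) as HTg; pose proof (HH v ltac:(lra)) as HTh.
  { simpl in *. pose proof (path_fellow g h Tg Th l Hg Hh Hgh) as D.
    rewrite Hgu, Hhv in D. pose proof (Hc u v). lra. }
  rewrite S_INR in HlH. simpl pow in Hlen.
  pose proof (Rmult_le_pos _ _ (pos_INR n) HL) as HnL.
  set (m := (u + v) / 2).
  destruct (path_exists (g 0) (c m)) as (k & Hk & Hk0 & Hk1).
  pose proof (HH m ltac:(unfold m; lra)) as HTk.
  set (l' := H - INR n * L).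
  assert (D1 : d (g l') (k l') <= 7 * K).
  { apply (IH u m g k Tg (d (g 0) (c m))); trivial; unfold m, l' in *; try lra; auto.
    - intros; apply Hc; lra.
    - intros; apply HH; lra. }
  assert (D2 : d (k l') (h l') <= 7 * K).
  { apply (IH m v k h (d (g 0) (c m)) Th); trivial; unfold m, l' in *; try lra.
    - intros; apply Hc; lra.
    - now rewrite Hk0.
    - intros; rewrite Hk0; apply HH; lra. }
  apply (Hcontr g h l'); trivial; unfold l' in *; try lra.
  - apply (path_restrict g Tg); trivial; lra.
  - apply (path_restrict h Th); trivial; lra.
  - pose proof (dist_tri (g (H - INR n * L)) (k (H - INR n * L)) (h (H - INR n * L))). lra.
Qed.

(** * Geodesics seen from a point, starting almost nearest to it *)

Section NearestPoint.
Variables (x : X) (c : R -> X) (T H : R).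
Hypothesis Hc : geodesic_path c T.
Hypothesis HH : forall t, 0 <= t <= T -> H <= d x (c t).
Hypothesis HH1 : d x (c 0) <= H + 1.

(** Going from [c 0] to [c t] down to height [H - INR n * L], across and up again takes at least
    [t]; nearly all of it must be spent above [H] on the side of [c t]. *)
Lemma dist_linear_growth n t :
  0 <= t <= T -> t <= 2 ^ n * K ->
  H + t - 2 * (INR n * L) - 7 * K - 1 <= d x (c t).
Proof.
  intros Ht Hn.
  pose proof (Rmult_le_pos _ _ (pos_INR n) HL) as HnL.
  pose proof (path_dist0 c T t Hc) as Dt.
  pose proof (dist_tri (c 0) x (c t)) as E. rewrite (dist_sym (c 0) x) in E.
  (* If that height is negative, [d x (c t) >= t - d x (c 0)] is enough. *)
  destruct (Rle_lt_dec 0 (H - INR n * L)) as [Hl|Hl]; [|lra].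
  destruct (path_exists x (c 0)) as (g & Hg & Hg0 & Hg1).
  destruct (path_exists x (c t)) as (h & Hh & Hh0 & Hh1).
  set (l := H - INR n * L) in *.
  assert (D : d (g l) (h l) <= 7 * K).
  { apply (outer_path_close n c H 0 t g h (d x (c 0)) (d x (c t))); trivial; try lra.
    - intros; rewrite (path_dist c T); trivial; lra.
    - congruence.
    - intros; rewrite Hg0; apply HH; lra.
    - unfold l; lra. }
  pose proof (HH 0). pose proof (HH t).
  pose proof (path_dist g _ l (d x (c 0)) Hg) as E1.
  pose proof (path_dist h _ l (d x (c t)) Hh) as E2.
  rewrite Hg1 in E1. rewrite Hh1 in E2.
  pose proof (dist_tri (c 0) (g l) (c t)) as E3.
  pose proof (dist_tri (g l) (h l) (c t)) as E4.
  rewrite (dist_sym (c 0) (g l)) in E3.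
  unfold l in *. lra.
Qed.

Variable j0 : nat.
Hypothesis Hj0 : forall j, (j0 <= j)%nat ->
  (4 * INR j + 3) * L + 7 * K + 1 <= 2 ^ j * K.

(** Linear growth loses [2 * (j + 1) * L] and bisection [j * L]; reaching height [H + (j + 1) * L]
    requires the rest of the coefficient [4 * j + 3] in [Hj0]. *)
Lemma dyadic_step j t g h :
  (j0 <= j)%nat -> 2 ^ j * K <= t <= 2 ^ (S j) * K -> t <= T ->
  geodesic_path g (d x (c (2 ^ j * K))) -> g 0 = x ->
  g (d x (c (2 ^ j * K))) = c (2 ^ j * K) ->
  geodesic_path h (d x (c t)) -> h 0 = x -> h (d x (c t)) = c t ->
  forall l, 0 <= l -> l <= H + (INR j + 1) * L -> d (g l) (h l) <= 7 * K.
Proof.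
  intros Hj Ht HtT Hg Hg0 Hg1 Hh Hh0 Hh1 l Hl HlH.
  specialize (Hj0 j Hj). simpl pow in Ht.
  apply (outer_path_close j c (H + 2 ^ j * K - 2 * (INR (S j) * L) - 7 * K - 1)
    (2 ^ j * K) t g h (d x (c (2 ^ j * K))) (d x (c t))); trivial; try lra.
  - intros; rewrite (path_dist c T); trivial; lra.
  - congruence.
  - intros s Hs. rewrite Hg0.
    pose proof (dist_linear_growth (S j) s) as D. simpl pow in D. lra.
  - rewrite S_INR. lra.
Qed.

(** Ensures that the geodesics compared in [dyadic_descent] are long enough to reach the comparison
    height. *)
Lemma dyadic_height k j t :
  (j0 <= j)%nat -> 2 ^ j * K <= t <= 2 ^ (j + S k) * K -> t <= T ->
  H + (INR j + 1) * L <= d x (c t).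
Proof.
  revert j. induction k as [|k IH]; intros j Hj Ht HtT;
    assert (H2 : 0 <= 2 ^ j * K) by (apply Rmult_le_pos; [apply pow_le|]; lra);
    pose proof (Rmult_le_pos _ _ (pos_INR j) HL) as HjL;
    (destruct (Rle_lt_dec t (2 ^ (S j) * K)) as [Htj|Htj];
      [specialize (Hj0 j Hj); pose proof (dist_linear_growth (S j) t) as D;
       rewrite S_INR in D; lra|]).
  - rewrite Nat.add_1_r in Ht. lra.
  - replace (j + S (S k))%nat with (S j + S k)%nat in Ht by lia.
    specialize (IH (S j)). rewrite S_INR in IH.
    assert (H + (INR j + 1 + 1) * L <= d x (c t)) by (apply IH; lia || lra). lra.
Qed.

(* The heights of the dyadic points grow faster than what the contraction costs, so the errors of the dyadic steps, added from the far end downwards, do not accumulate. *)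
Lemma dyadic_descent k j t g h :
  (j0 <= j)%nat -> 2 ^ j * K <= t <= 2 ^ (j + S k) * K -> t <= T ->
  geodesic_path g (d x (c (2 ^ j * K))) -> g 0 = x ->
  g (d x (c (2 ^ j * K))) = c (2 ^ j * K) ->
  geodesic_path h (d x (c t)) -> h 0 = x -> h (d x (c t)) = c t ->
  forall l, 0 <= l -> l <= H + INR j * L -> d (g l) (h l) <= 7 * K.
Proof.
  revert j g. induction k as [|k IH]; intros j g Hj Ht HtT Hg Hg0 Hg1 Hh Hh0 Hh1 l Hl HlH.
  { rewrite Nat.add_1_r in Ht. apply (dyadic_step j t g h); trivial. lra. }
  destruct (Rle_lt_dec t (2 ^ (S j) * K)) as [Htj|Htj].
  { apply (dyadic_step j t g h); trivial; lra. }
  destruct (path_exists x (c (2 ^ S j * K))) as (m & Hm & Hm0 & Hm1).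
  assert (H2 : 0 <= 2 ^ j * K) by (apply Rmult_le_pos; [apply pow_le|]; lra).
  assert (HS : 2 ^ S j * K = 2 * (2 ^ j * K)) by (simpl; ring).
  pose proof (dyadic_height (S k) j t Hj Ht HtT) as HTh.
  pose proof (dyadic_height 0 j (2 ^ j * K) Hj) as HTg.
  rewrite Nat.add_1_r in HTg.
  set (l' := H + (INR j + 1) * L) in *.
  assert (D1 : d (g l') (m l') <= 7 * K).
  { apply (dyadic_step j (2 ^ S j * K) g m); trivial; unfold l' in *; lra. }
  assert (D2 : d (m l') (h l') <= 7 * K).
  { apply (IH (S j) m); trivial; try (unfold l'; rewrite ?S_INR; lra); try lia.
    replace (S j + S k)%nat with (j + S (S k))%nat by lia. lra. }
  pose proof (dist_tri (g l') (m l') (h l')).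
  apply (Hcontr g h l'); trivial; try (unfold l' in *; lra).
  - apply (path_restrict g _ l' Hg); unfold l' in *; lra.
  - apply (path_restrict h _ l' Hh); unfold l' in *; lra.
  - congruence.
Qed.

Lemma near_end h Th :
  geodesic_path h Th -> h 0 = x -> h Th = c T ->
  exists l, 0 <= l <= Th /\ d (c 0) (h l) <= 14 * K + INR j0 * L + 1.
Proof.
  intros Hh Hh0 Hh1.
  pose proof (proj1 Hc) as HT. pose proof (proj1 Hh) as HTh.
  pose proof (path_dist0 h Th Th Hh HTh (Rle_refl _)) as ETh.
  rewrite Hh0, Hh1 in ETh. subst Th.
  pose proof (Rmult_le_pos _ _ (pos_INR j0) HL) as HjL.
  pose proof (HH 0 ltac:(lra)) as E0. pose proof (HH T ltac:(lra)) as ET.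
  destruct (Rle_lt_dec 0 (H - INR j0 * L)) as [Hl|Hl].
  (* For small [H], the point [x] itself is near [c 0]. *)
  2:{ exists 0. split; [lra|]. rewrite Hh0, dist_sym. lra. }
  destruct (path_exists x (c 0)) as (g & Hg & Hg0 & Hg1).
  set (l := H - INR j0 * L) in *. exists l. split; [unfold l in *; lra|].
  assert (D : d (g l) (h l) <= 14 * K).
  (* A short path needs one bisection; a long one passes through the dyadic point [2 ^ j0 * K], with
     [7 * K] before it and [7 * K] after it. *)
  { destruct (Rle_lt_dec T (2 ^ j0 * K)) as [HTj|HTj].
    - apply Rle_trans with (7 * K); [|lra].
      apply (outer_path_close j0 c H 0 T g h (d x (c 0)) (d x (c T))); trivial; try lra.
      + intros; rewrite (path_dist c T); trivial; lra.
      + congruence.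
      + intros; rewrite Hg0; apply HH; lra.
      + unfold l; lra.
    - assert (H2 : 0 <= 2 ^ j0 * K) by (apply Rmult_le_pos; [apply pow_le|]; lra).
      destruct (path_exists x (c (2 ^ j0 * K))) as (m & Hm & Hm0 & Hm1).
      assert (D1 : d (g l) (m l) <= 7 * K).
      { apply (outer_path_close j0 c H 0 (2 ^ j0 * K) g m (d x (c 0)) (d x (c (2 ^ j0 * K))));
          trivial; try lra.
        - intros; rewrite (path_dist c T); trivial; lra.
        - congruence.
        - intros; rewrite Hg0; apply HH; lra.
        - unfold l; lra. }
      assert (Hk : exists k, T <= 2 ^ (j0 + S k) * K).
      { destruct (Pow_x_infinity 2 ltac:(rewrite Rabs_pos_eq; lra) T) as [k Hk].
        exists k. specialize (Hk (j0 + S k)%nat ltac:(lia)).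
        rewrite Rabs_pos_eq in Hk by (apply pow_le; lra).
        pose proof (Rmult_le_compat_l (2 ^ (j0 + S k)) 1 K ltac:(apply pow_le; lra) HK). lra. }
      destruct Hk as [k Hk].
      assert (D2 : d (m l) (h l) <= 7 * K).
      { apply (dyadic_descent k j0 T m h); trivial; try lra; try lia. unfold l; lra. }
      pose proof (dist_tri (g l) (m l) (h l)). lra. }
  pose proof (path_dist g _ l (d x (c 0)) Hg) as E1. rewrite Hg1 in E1.
  pose proof (dist_tri (c 0) (g l) (h l)) as E2.
  rewrite (dist_sym (c 0) (g l)) in E2. unfold l in *. lra.
Qed.
End NearestPoint.
End Divergence.

(** * Centres of triangles and thinness *)

Lemma dyadic_threshold L :
  0 <= L -> exists j0, forall j, (j0 <= j)%nat ->
  (4 * INR j + 3) * L + 7 * K + 1 <= 2 ^ j * K.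
Proof.
  intros HL. set (A := 4 * L + 7 * K + 1).
  destruct (INR_archimed 1 (9 * A)) as [j0 Hj0]; [lra|].
  exists j0. intros j Hj. apply le_INR in Hj.
  (* A quadratic lower bound for [2 ^ j] beats the linear left side once [j > 9 * A]. *)
  assert (Hq : (INR j + 3) * (INR j + 3) <= 9 * 2 ^ j).
  { clear. induction j as [|j IH]; [simpl; lra|].
    rewrite S_INR. simpl pow. pose proof (pos_INR j). nra. }
  pose proof (pos_INR j).
  assert (A * (INR j + 1) <= 2 ^ j) by (unfold A in *; nra).
  assert (2 ^ j * 1 <= 2 ^ j * K) by (apply Rmult_le_compat_l; [apply pow_le|]; lra).
  apply Rle_trans with (A * (INR j + 1)); [|lra].
  unfold A. nra.
Qed.

Lemma approx_nearest (x : X) (c : R -> X) T :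
  0 <= T -> exists t0, 0 <= t0 <= T /\
    forall t, 0 <= t <= T -> d x (c t0) - 1 <= d x (c t).
Proof.
  intros HT.
  set (E := fun r => exists t, 0 <= t <= T /\ r = d x (c t)).
  destruct (Glb_Rbar_correct E) as [Hlb Hglb].
  assert (H1 : Rbar_le 0 (Glb_Rbar E)).
  { apply Hglb. intros r (t & _ & ->). apply dist_ge0. }
  assert (H2 : forall t, 0 <= t <= T -> Rbar_le (Glb_Rbar E) (d x (c t))).
  { intros t Ht. apply Hlb. now exists t. }
  destruct (Glb_Rbar E) as [l| |]; simpl in *;
    [|destruct (H2 T); lra|easy].
  apply Classical_Prop.NNPP. intros HN.
  assert (H3 : Rbar_le (Finite (l + 1)) (Finite l)).
  { apply Hglb. intros r (t & Ht & ->). simpl. apply Rnot_lt_le. intros Hl.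
    apply HN. exists t. split; trivial. intros t' Ht'. specialize (H2 t' Ht'). lra. }
  simpl in H3. lra.
Qed.

(** Cut [y,z] at a point [p] almost nearest to [x] and apply [near_end] to both halves, each
    parametrized from [p]. *)
Lemma triangle_center :
  exists K1, 0 <= K1 /\ forall x y z Sxy Syz Szx,
    geodesic_segment d x y Sxy -> geodesic_segment d y z Syz ->
    geodesic_segment d z x Szx ->
    exists u p v, Sxy u /\ Syz p /\ Szx v /\ d p u <= K1 /\ d p v <= K1.
Proof.
  destruct (path_contraction (14 * K)) as (L & HL & Hcontr); [lra|].
  destruct (dyadic_threshold L HL) as [j0 Hj0].
  exists (14 * K + INR j0 * L + 1).
  pose proof (Rmult_le_pos _ _ (pos_INR j0) HL).
  split; [lra|]. intros x y z Sxy Syz Szx Hxy Hyz Hzx.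
  destruct (segment_path _ _ _ Hxy) as (g & Hg & Hg0 & Hg1 & Hgin).
  destruct (segment_path _ _ _ Hyz) as (c & Hc & Hc0 & Hc1 & Hcin).
  destruct (segment_path _ _ _ (segment_sym _ _ _ Hzx)) as (h & Hh & Hh0 & Hh1 & Hhin).
  destruct (approx_nearest x c (d y z)) as (t0 & Ht0 & Hmin); [apply dist_ge0|].
  destruct (near_end L HL Hcontr x (fun t => c (t0 - t)) t0 (d x (c t0) - 1))
    with (j0 := j0) (h := g) (Th := d x y) as (l & Hl & Hlg); trivial.
  { apply (path_reverse c (d y z)); trivial; lra. }
  { intros; apply Hmin; lra. }
  { rewrite Rminus_0_r; lra. }
  { rewrite Rminus_diag; congruence. }
  destruct (near_end L HL Hcontr x (fun t => c (t0 + t)) (d y z - t0) (d x (c t0) - 1))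
    with (j0 := j0) (h := h) (Th := d x z) as (m & Hm & Hmh); trivial.
  { apply (path_shift c (d y z)); trivial; lra. }
  { intros; apply Hmin; lra. }
  { rewrite Rplus_0_r; lra. }
  { replace (t0 + (d y z - t0)) with (d y z) by lra; congruence. }
  rewrite Rminus_0_r in Hlg. rewrite Rplus_0_r in Hmh.
  exists (g l), (c t0), (h m).
  repeat split; trivial; [apply Hgin|apply Hcin|apply Hhin]; eauto.
Qed.

(** Compare at equal height by [path_fellow]; if [q] is higher than [v], then [v] itself is within
    [2 * e]. *)
Lemma corner_thin x y z S S' u v q e :
  geodesic_segment d x y S -> geodesic_segment d x z S' ->
  S u -> S' v -> d u v <= e -> S q -> d x q <= d x u ->
  exists q', S' q' /\ d q q' <= 4 * e + K.
Proof.
  intros HS HS' Hu Hv Huv Hq Hqu.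
  pose proof (dist_ge0 u v) as He.
  destruct (segment_path _ _ _ HS) as (g & Hg & Hg0 & Hg1 & Hin).
  destruct (segment_path _ _ _ HS') as (h & Hh & Hh0 & Hh1 & Hin').
  apply Hin in Hu. destruct Hu as (a & Ha & <-).
  apply Hin in Hq. destruct Hq as (l & Hl & <-).
  apply Hin' in Hv. destruct Hv as (b & Hb & <-).
  pose proof (path_dist0 g _ a Hg) as E1. pose proof (path_dist0 g _ l Hg) as E2.
  pose proof (path_dist0 h _ b Hh) as E3. rewrite Hg0 in *. rewrite Hh0 in *.
  destruct (Rle_lt_dec l b) as [Hlb|Hlb].
  - exists (h l). split; [apply Hin'; exists l; split; [lra|reflexivity]|].
    pose proof (path_fellow g h a b l) as D.
    apply Rle_trans with (4 * d (g a) (h b) + K); [|lra].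
    apply D; try lra.
    + apply (path_restrict g _ a Hg); lra.
    + apply (path_restrict h _ b Hh); lra.
    + congruence.
  - exists (h b). split; [apply Hin'; exists b; split; [lra|reflexivity]|].
    pose proof (path_dist g _ l a Hg). pose proof (dist_tri (g l) (g a) (h b)).
    pose proof (dist_tri x (h b) (g a)). rewrite (dist_sym (h b) (g a)) in *. lra.
Qed.

(** The point [u] cuts the side into two corners, at [x] closed by [v] and at [y] closed by [p]. *)
Lemma side_thin x y z Sxy Syz Szx u p v e :
  geodesic_segment d x y Sxy -> geodesic_segment d y z Syz ->
  geodesic_segment d z x Szx -> Sxy u -> Syz p -> Szx v ->
  d u v <= e -> d u p <= e ->
  in_closed_nbhd d Sxy (set_union Syz Szx) (4 * e + K).
Proof.
  intros Hxy Hyz Hzx Hu Hp Hv Huv Hup q Hq.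
  destruct (Rle_lt_dec (d x q) (d x u)) as [Hqu|Hqu].
  - destruct (corner_thin x y z Sxy Szx u v q e) as (q' & Hq' & Hd); trivial.
    { now apply segment_sym. }
    exists q'. split; trivial. now right.
  - pose proof (segment_dist _ _ _ _ Hxy Hu). pose proof (segment_dist _ _ _ _ Hxy Hq).
    destruct (corner_thin y x z Sxy Syz u p q e) as (q' & Hq' & Hd); trivial.
    { now apply segment_sym. }
    { rewrite (dist_sym y q), (dist_sym y u). lra. }
    exists q'. split; trivial. now left.
Qed.

Lemma lens_hyperbolic : hyperbolic d.
Proof.
  destruct triangle_center as (K1 & HK1 & Hcenter).
  exists (4 * (2 * K1) + K). split; [lra|].
  intros x y z Sxy Syz Szx Hxy Hyz Hzx.
  destruct (Hcenter x y z Sxy Syz Szx Hxy Hyz Hzx) as (u & p & v & Hu & Hp & Hv & Hpu & Hpv).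
  assert (Huv : d u v <= 2 * K1).
  { pose proof (dist_tri u p v). rewrite (dist_sym u p) in *. lra. }
  split; [|split].
  - apply (side_thin x y z Sxy Syz Szx u p v); trivial. rewrite dist_sym; lra.
  - apply (side_thin y z x Syz Szx Sxy p v u); trivial; lra.
  - apply (side_thin z x y Szx Sxy Syz v u p); trivial; rewrite dist_sym; lra.
Qed.

End Lens.
End Geodesics.

Theorem theorem1 (X : Type) (d : X -> X -> R)
  (Hmetric : is_metric d) (Hgeod : geodesic_space d) :
  hyperbolic d <->
  exists C : R, 0 <= C /\
    forall (x y : X) (s t : R), 0 <= s -> 0 <= t ->
      (exists z, set_inter (cball d x s) (cball d y t) z) ->
      exists (xi : X) (R0 : R), 0 <= R0 /\
        Rbar_le (hausdorff d (set_inter (cball d x s) (cball d y t))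
                             (cball d xi R0))
                (Finite C).
Proof.
  split.
  - intros [delta Hd]. exists (2 * delta). split; [destruct Hd; lra|].
    intros. now apply hyperbolic_ball_inter.
  - intros (C & HC & Hball). apply (lens_hyperbolic d Hmetric Hgeod (6 * (C + 1))).
    + lra.
    + now apply ball_inter_lens_bound.
Qed.
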